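(* There exists a probability distribution $\mu$ (on $\mathbb{R}_+$) such that $\mu\in\mathcal{S}_{loc}\setminus\mathcal{US}_{loc}$ and $\mu^{2*}\in\mathcal{S}_{ac}$.
   Context: For positive functions $f,g$ defined on some $[a,\infty)$, $f(x)\sim g(x)$ means $\lim_{x\to\infty}f(x)/g(x)=1$. A density function is a measurable $g:\mathbb{R}\to[0,\infty)$ with $\int g=1$. For integrable $f,g$, $f\otimes g(x):=\int f(x-u)g(u)\,du$; $\eta*\rho$ denotes convolution of measures and $\rho^{n*}$ the $n$-th convolution power. The class $\mathbf{L}$ consists of nonnegative measurable $g$ on $\mathbb{R}$ with $g(x)>0$ for all sufficiently large $x$ and $g(x+a)\sim g(x)$ for every $a\in\mathbb{R}$. $\mathcal{L}_d$ is the set of density functions in $\mathbf{L}$; $\mathcal{S}_d$ is the set of $g\in\mathcal{L}_d$ with $g\otimes g(x)\sim 2g(x)$. $\mathcal{S}_{ac}$ is the class of distributions $\rho(dx)=g(x)dx$ with $g\in\mathcal{S}_d$. For $\Delta=(0,c]$, $c>0$: a distribution $\rho$ belongs to $\mathcal{L}_\Delta$ if $x\mapsto\rho((x,x+c])$ belongs to $\mathbf{L}$, and to $\mathcal{S}_\Delta$ if moreover $\rho*\rho((x,x+c])\sim 2\rho((x,x+c])$. $\mathcal{L}_{loc}$ (resp. $\mathcal{S}_{loc}$) is the class of distributions in $\mathcal{L}_\Delta$ (resp. $\mathcal{S}_\Delta$) for every $\Delta=(0,c]$, $c>0$. $\mathcal{UL}_{loc}$ is the class of $\rho\in\mathcal{L}_{loc}$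 for which there is $p\in\mathcal{L}_d$ with $c^{-1}\rho((x-c,x])\sim p(x)$ uniformly in $c\in(0,1]$; $\mathcal{US}_{loc}$ is the class of $\rho\in\mathcal{S}_{loc}$ for which there is $p\in\mathcal{S}_d$ with $c^{-1}\rho((x-c,x])\sim p(x)$ uniformly in $c\in(0,1]$. *)

(* Defs.v *)
From mathcomp Require Import all_boot all_order all_algebra.
From mathcomp Require Import all_classical all_reals all_analysis.
Import Order.TTheory GRing.Theory Num.Theory numFieldNormedType.Exports.
Set Implicit Arguments. Unset Strict Implicit. Unset Printing Implicit Defensive.
Local Open Scope classical_set_scope.
Local Open Scope ring_scope.

Section HeavyTail.
Variable R : realType.

Definition asympt (f g : R -> \bar R) : Prop :=
  (\forall x \near +oo%R, (0 < f x < +oo)%E /\ (0 < g x < +oo)%E) /\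
  (fine (f x) / fine (g x)) @[x --> +oo%R] --> (1 : R).

Definition asymptR (f g : R -> R) : Prop :=
  asympt (fun x => (f x)%:E) (fun x => (g x)%:E).

Definition classL (g : R -> R) : Prop :=
  measurable_fun setT g /\ (forall x, 0 <= g x) /\
  (\forall x \near +oo%R, 0 < g x) /\
  (forall a : R, asymptR (fun x => g (x + a)) g).

Definition density (g : R -> R) : Prop :=
  measurable_fun setT g /\ (forall x, 0 <= g x) /\
  (\int[lebesgue_measure]_x (g x)%:E = 1)%E.

Definition dconv (f g : R -> R) (x : R) : \bar R :=
  (\int[lebesgue_measure]_u (f (x - u) * g u)%:E)%E.

Definition Ld (g : R -> R) : Prop := density g /\ classL g.

Definition Sd (g : R -> R) : Prop :=
  Ld g /\ asympt (dconv g g) (fun x => (2 * g x)%:E).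

Definition mconv (eta rho : probability R R) (A : set R) : \bar R :=
  (\int[eta]_x rho [set y | A (x + y)%R])%E.

Definition Ioc (a b : R) : set R := [set y | a < y <= b].

Definition Sac (rho : set R -> \bar R) : Prop :=
  exists g : R -> R, Sd g /\
    forall A : set R, measurable A ->
      rho A = (\int[lebesgue_measure]_(x in A) (g x)%:E)%E.

Definition LDelta (c : R) (rho : probability R R) : Prop :=
  classL (fun x => fine (rho (Ioc x (x + c)))).

Definition SDelta (c : R) (rho : probability R R) : Prop :=
  LDelta c rho /\
  asympt (fun x => mconv rho rho (Ioc x (x + c)))
         (fun x => (2%:E * rho (Ioc x (x + c)))%E).

Definition Lloc (rho : probability R R) : Prop :=
  forall c : R, 0 < c -> LDelta c rho.

Definition Sloc (rho : probability R R) : Prop :=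
  forall c : R, 0 < c -> SDelta c rho.

Definition unif_local_asympt (rho : probability R R) (p : R -> R) : Prop :=
  forall eps : R, 0 < eps ->
    \forall x \near +oo%R, forall c : R, 0 < c <= 1 ->
      `| c^-1 * fine (rho (Ioc (x - c) x)) / p x - 1 | < eps.

Definition ULloc (rho : probability R R) : Prop :=
  Lloc rho /\ exists p : R -> R, Ld p /\ unif_local_asympt rho p.

Definition USloc (rho : probability R R) : Prop :=
  Sloc rho /\ exists p : R -> R, Sd p /\ unif_local_asympt rho p.

End HeavyTail.

(* Main.v *)
(* Let k(x) = 1/(1+x^2), and let mu have density f proportional to k on [0, oo)
   with the holes (n, n + 2^-(n+1)] cut out.  The holes have finite total
   length, so they are invisible at infinity after one averaging: both the mass
   of a fixed-length interval and the convolution of f with itself are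
   asymptotically unchanged, while choosing c equal to the length of a hole
   makes c^-1 mu((x-c, x]) vanish, which rules out uniformity in c.

   Every convolution is split at x/2, where k(x-u) <= 4 k(x) allows dominated
   convergence; the holes contribute at most a constant times k(x) times their
   length beyond x/2.  This gives (f * f)(x) ~ 2 a k(x) when f = a k off the
   holes, and the same argument then applies to g = f * f, which no longer has
   holes. *)
From HB Require Import structures.
Require Import Defs.
From mathcomp Require Import all_boot all_order all_algebra.
From mathcomp Require Import all_classical all_reals all_analysis.
From mathcomp Require Import measurable_realfun ring lra.
Import Order.TTheory GRing.Theory Num.Theory numFieldNormedType.Exports.
Set Implicit Arguments.
Unset Strict Implicit.
Unset Printing Implicit Defensive.
Local Open Scope classical_set_scope.
Local Open Scope ring_scope.

(** * Invariance of Lebesgue measure under reflections *)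

Section reflection.
Variable R : realType.
Notation lambda := (@lebesgue_measure R).

Lemma measurable_reflect (c : R) : measurable_fun setT (fun x : R => c - x).
Proof. exact: measurable_funB. Qed.

(** Lebesgue measure is determined by its values on the intervals []a, b]], and such an interval is
    pulled back to [[c - b, c - a[], of the same length. *)
Lemma lebesgue_measure_reflect (c : R) (A : set R) : measurable A ->
  lambda [set x | A (c - x)] = lambda A.
Proof.
move=> mA; pose T : measurableTypeR R -> measurableTypeR R := fun x => c - x.
have mT : measurable_fun setT T := measurable_reflect c.
apply/esym.
rewrite (@lebesgue_measure_unique R (pushforward lambda T))// => X [[a b] _ <-].
have TE : T @^-1` `]a, b] = `[c - b, c - a[%classic.
  by apply/seteqP; split => x /=; rewrite /T !in_itv/=; lra.
change (lambda `]a, b] = lambda (T @^-1` `]a, b])).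
rewrite TE !lebesgue_measure_itv/= !lte_fin.
have -> : (c - b < c - a) = (a < b) by apply/idP/idP; lra.
by case: ifP => // _; rewrite -!EFinD; congr EFin; lra.
Qed.

Lemma ge0_integral_reflect (c : R) (D : set R) (F : R -> \bar R) :
  measurable D -> measurable_fun D F -> (forall x, D x -> 0 <= F x)%E ->
  (\int[lambda]_(x in D) F x =
   \int[lambda]_(x in [set x | D (c - x)%R]) F (c - x)%R)%E.
Proof.
move=> mD mF F0.
pose T : measurableTypeR R -> measurableTypeR R := fun x => c - x.
have mT : measurable_fun setT T := measurable_reflect c.
rewrite -(@ge0_integral_pushforward _ _ _ _ _ T mT lambda D F)//.
  by apply: eq_measure_integral => A mA _; exact/esym/lebesgue_measure_reflect.
by move=> x /[!inE]; exact: F0.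
Qed.

Lemma ge0_integral_reflectT (c : R) (F : R -> \bar R) :
  measurable_fun setT F -> (forall x, 0 <= F x)%E ->
  (\int[lambda]_x F x = \int[lambda]_x F (c - x)%R)%E.
Proof.
by move=> mF F0; rewrite (@ge0_integral_reflect c)// => x _; exact: F0.
Qed.

End reflection.

(** * The probability measure with a given density *)

Section density_probability.
Variables (R : realType) (f : R -> R).
Notation lambda := (@lebesgue_measure R).

(** The proof [df] is carried as an argument so that the measure and probability instances below can
    be inferred from the term itself. *)
Definition density_prob (df : density f) (A : set (measurableTypeR R)) :
    \bar R :=
  (\int[lambda]_(x in A) (f x)%:E)%E.

Hypothesis df : density f.

Let mf : measurable_fun setT (EFin \o f).
Proof. by apply/measurable_EFinP; case: df. Qed.

Let f0 x : (0 <= (f x)%:E)%E.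
Proof. by case: df => _ [f0 _]; rewrite lee_fin. Qed.

Let density_prob0 : density_prob df set0 = 0%E.
Proof. exact: integral_set0. Qed.

Let density_prob_ge0 A : (0 <= density_prob df A)%E.
Proof. exact: integral_ge0. Qed.

Let density_prob_sigma_additive : semi_sigma_additive (density_prob df).
Proof. exact: semi_sigma_additive_nng_induced. Qed.

HB.instance Definition _ := isMeasure.Build _ _ _ (density_prob df)
  density_prob0 density_prob_ge0 density_prob_sigma_additive.

Let density_probT : density_prob df setT = 1%E.
Proof. by have [_ []] := df. Qed.

HB.instance Definition _ := @Measure_isProbability.Build _ _ R
  (density_prob df) density_probT.

Lemma density_prob_dominates : density_prob df `<< lambda.
Proof.
apply/null_content_dominatesP => A mA A0.
by apply: null_set_integral => //; exact: measurable_funTS.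
Qed.

Lemma integral_density_prob (F : R -> \bar R) : measurable_fun setT F ->
  (forall x, 0 <= F x)%E ->
  (\int[density_prob df]_x F x = \int[lambda]_x (F x * (f x)%:E))%E.
Proof.
move=> mF F0.
have dom := density_prob_dominates.
rewrite -(Radon_Nikodym_SigmaFinite.change_of_variables dom)//.
have iRN := Radon_Nikodym_SigmaFinite.f_integrable dom.
have mRN := measurable_int _ iRN.
apply: ae_eq_integral => //.
- exact: emeasurable_funM.
- exact: emeasurable_funM.
(* The change of variables produces the Radon-Nikodym derivative; it equals [f] almost everywhere
   because both have the same integral over every measurable set. *)
- apply: ae_eqe_mul2l; apply: integral_ae_eq => //.
  by move=> E _ mE; rewrite -Radon_Nikodym_SigmaFinite.f_integral.
Qed.

End density_probability.

(** * Laws on the line and the density of their convolution *)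

Section law_of_density.
Variable R : realType.
Notation lambda := (@lebesgue_measure R).

Lemma ge0_integral_translate (c : R) (F : R -> \bar R) :
  measurable_fun setT F -> (forall x, 0 <= F x)%E ->
  (\int[lambda]_x F x = \int[lambda]_x F (c + x)%R)%E.
Proof.
(* A translation is the composite of the reflections through [c] and [0]. *)
move=> mF F0; rewrite (ge0_integral_reflectT c)//.
rewrite (@ge0_integral_reflectT _ 0 (fun x => F (c - x)))//.
  by under eq_integral do rewrite sub0r opprK.
exact: measurableT_comp mF (measurable_reflect c).
Qed.

Let id_measurableTypeR : measurableTypeR R -> R := idfun.

HB.instance Definition _ := @isMeasurableFun.Build _ _ _ _ id_measurableTypeR
  (@measurable_id _ _ setT).

(* Lebesgue measure lives on [measurableTypeR R], whose display differs from
   that of [R]; the identity moves the measure from one to the other. *)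
Definition law (f : R -> R) (df : density f) : probability R R :=
  distribution (density_prob df) id_measurableTypeR.

Variables (f : R -> R) (df : density f).

Lemma lawE (A : set R) : law df A = (\int[lambda]_(x in A) (f x)%:E)%E.
Proof. by []. Qed.

Lemma integral_law (F : R -> \bar R) : measurable_fun setT F ->
  (forall x, 0 <= F x)%E ->
  (\int[law df]_x F x = \int[lambda]_x (F x * (f x)%:E))%E.
Proof.
move=> mF F0; rewrite ge0_integral_distribution//.
exact: integral_density_prob.
Qed.

Lemma measurable_conv_integrand (g h : R -> R) :
  measurable_fun setT g -> measurable_fun setT h ->
  measurable_fun [set: measurableTypeR R * measurableTypeR R]
    (fun p => (g (p.2 - p.1) * h p.1)%:E).
Proof.
move=> mg mh; apply/measurable_EFinP/measurable_funM.
  by apply: (measurableT_comp mg); apply: measurable_funB;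
    [exact: measurable_snd | exact: measurable_fst].
by apply: (measurableT_comp mh); exact: measurable_fst.
Qed.

Lemma measurable_dconv (g h : R -> R) :
  measurable_fun setT g -> (forall x, 0 <= g x) ->
  measurable_fun setT h -> (forall x, 0 <= h x) ->
  measurable_fun setT (dconv g h).
Proof.
move=> mg g0 mh h0.
apply: (@measurable_fun_fubini_tonelli_G _ _ (measurableTypeR R)
  (measurableTypeR R) R lambda (fun p => (g (p.2 - p.1) * h p.1)%:E)).
  exact: measurable_conv_integrand.
by move=> p; rewrite lee_fin mulr_ge0.
Qed.

(** Tonelli: translating the inner integral by [x] turns the mass of the shifted set into the
    integral of [f (z - x)] over [z] in [A], after which the two integrals are exchanged. *)
Lemma mconv_law (A : set R) : measurable A ->
  mconv (law df) (law df) A = (\int[lambda]_(z in A) dconv f f z)%E.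
Proof.
move=> mA; have [mf [f0 _]] := df.
pose K (p : measurableTypeR R * measurableTypeR R) :=
  ((\1_A p.2)%:E * (f (p.2 - p.1) * f p.1)%:E)%E.
have mK : measurable_fun setT K.
  apply: emeasurable_funM; last exact: measurable_conv_integrand.
  apply/measurable_EFinP.
  apply: (measurableT_comp (measurable_indic mA)); exact: measurable_snd.
have K0 p : (0 <= K p)%E by rewrite /K -EFinM lee_fin !mulr_ge0.
(* [H] is [K] without the factor [f p.1], which comes from the density of the outer measure. *)
pose H (p : measurableTypeR R * measurableTypeR R) :=
  ((\1_A p.2)%:E * (f (p.2 - p.1))%:E)%E.
have mH : measurable_fun setT H.
  apply: emeasurable_funM; apply/measurable_EFinP.
    apply: (measurableT_comp (measurable_indic mA)); exact: measurable_snd.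
  apply: (measurableT_comp mf); apply: measurable_funB.
    exact: measurable_snd.
  exact: measurable_fst.
have H0 p : (0 <= H p)%E by rewrite /H -EFinM lee_fin !mulr_ge0.
have PE x : law df [set y | A (x + y)] = (\int[lambda]_z H (x, z))%E.
  rewrite lawE integral_mkcond.
  rewrite (@ge0_integral_translate x (fun z => H (x, z)))//; last first.
    exact: (measurableT_comp mH (measurable_pair1 x)).
  apply: eq_integral => y _; rewrite patchE /H/= -EFinM indicE addrAC subrr add0r.
  rewrite (_ : (y \in _) = (x + y \in A)); last by apply/idP/idP; rewrite !inE.
  by case: ifP => _; rewrite ?mul1r ?mul0r.
rewrite /mconv; under eq_integral do rewrite PE.
rewrite integral_law//; last 2 first.
- exact: (@measurable_fun_fubini_tonelli_F _ _ _ _ R lambda H mH H0).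
- by move=> x; exact: integral_ge0.
transitivity (\int[lambda]_x \int[lambda]_z K (x, z))%E.
  apply: eq_integral => x _; rewrite muleC -ge0_integralZl//; last first.
  - by rewrite lee_fin.
  - exact: (measurableT_comp mH (measurable_pair1 x)).
  by apply: eq_integral => z _; rewrite /K /H -!EFinM; congr EFin; ring.
rewrite fubini_tonelli// [RHS]integral_mkcond; apply: eq_integral => z _.
rewrite /K/= ge0_integralZl//; last 2 first.
- exact: (measurableT_comp (measurable_conv_integrand mf mf) (measurable_pair2 z)).
- by move=> x _; rewrite lee_fin mulr_ge0.
by rewrite patchE indicE; case: ifP; rewrite ?mul1e ?mul0e.
Qed.

End law_of_density.

(** * The reference weight and its behaviour under shifts *)

Section cauchy_weight.
Variable R : realType.

Definition cauchy_weight (x : R) : R := (1 + x ^+ 2)^-1.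

Lemma cauchy_gt0 x : 0 < cauchy_weight x.
Proof. by rewrite invr_gt0 ltr_wpDr// sqr_ge0. Qed.

Lemma cauchy_ge0 x : 0 <= cauchy_weight x.
Proof. exact/ltW/cauchy_gt0. Qed.

Lemma cauchy_le1 x : cauchy_weight x <= 1.
Proof.
by rewrite invf_le1 ?lerDl ?sqr_ge0// ltr_wpDr// sqr_ge0.
Qed.

Lemma measurable_cauchy : measurable_fun setT cauchy_weight.
Proof. exact: continuous_measurable_fun (@continuous_oneDsqrV R). Qed.

Lemma cauchy_half x u : 0 <= u <= x / 2 ->
  cauchy_weight (x - u) <= 4 * cauchy_weight x.
Proof.
move=> /andP[u0 ux].
rewrite /cauchy_weight -[4]invrK -invfM lef_pV2 ?posrE; last 2 first.
- by rewrite ltr_wpDr// sqr_ge0.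
- by rewrite mulr_gt0 ?invr_gt0// ltr_wpDr// sqr_ge0.
have : (x / 2) ^+ 2 <= (x - u) ^+ 2 by rewrite ler_sqr ?nnegrE; lra.
by rewrite expr_div_n; lra.
Qed.

Lemma cauchy_shift (u : R) :
  cauchy_weight (x - u) / cauchy_weight x @[x --> +oo] --> (1 : R).
Proof.
apply/cvgrPdist_le => /= e e0; near=> x.
have x1 : 1 <= x - u.
  by rewrite lerBrDr; near: x; exact: nbhs_pinfty_ge (num_real _).
(* The error is a quotient, linear over quadratic in [x - u]; this threshold makes the numerator at
   most [e * (x - u) ^+ 2]. *)
have xe : `|u| * (2 + `|u|) / e <= x - u.
  by rewrite lerBrDr; near: x; exact: nbhs_pinfty_ge (num_real _).
have d0 : 0 < 1 + (x - u) ^+ 2 by nra.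
have -> : 1 - cauchy_weight (x - u) / cauchy_weight x =
    - (u * (2 * (x - u) + u)) / (1 + (x - u) ^+ 2).
  by rewrite /cauchy_weight invrK; field; rewrite gt_eqF.
rewrite normrM normfV (gtr0_norm d0) normrN normrM ler_pdivrMr//.
have : `|2 * (x - u) + u| <= (2 + `|u|) * (x - u).
  apply: (le_trans (ler_normD _ _)); rewrite ger0_norm; last lra.
  have := normr_ge0 u; nra.
move: xe; rewrite ler_pdivrMr// => xe h.
apply: (@le_trans _ _ (`|u| * ((2 + `|u|) * (x - u)))); first exact: ler_wpM2l.
nra.
Unshelve. all: by end_near. Qed.

Lemma integral_cauchy_fin :
  (\int[@lebesgue_measure R]_(x in `[0%R, +oo[)
     (cauchy_weight x)%:E < +oo)%E.
Proof. by rewrite integral0y_oneDsqr ltry. Qed.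

Lemma cvg_shift_pinfty (u : R) : (x - u) @[x --> +oo] --> +oo.
Proof.
apply/cvgryPge => A; near=> x; rewrite lerBrDr; near: x.
exact: nbhs_pinfty_ge (num_real _).
Unshelve. all: by end_near. Qed.

End cauchy_weight.

(** * Convolution restricted to the range where the weight is comparable to its value at x *)

Section half_convolution.
Variable R : realType.
Notation lambda := (@lebesgue_measure R).
Notation k := (@cauchy_weight R).

(** Taking [phi] equal to [h] gives half of a self-convolution; taking [phi] an indicator gives the
    mass of an interval. *)
Definition half_conv (h phi : R -> R) (x : R) : \bar R :=
  (\int[lambda]_(u in `[0%R, (x / 2)%R]) (h (x - u) * phi u)%:E)%E.

Variables (h phi : R -> R) (C m : R).
Hypotheses (mh : measurable_fun setT h) (h0 : forall x, 0 <= h x)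
  (hC : forall x, h x <= C * k x).
Hypotheses (mphi : measurable_fun setT phi) (phi0 : forall x, 0 <= phi x)
  (phiN : forall x : R, x < 0 -> phi x = 0)
  (phi_int : (\int[lambda]_x (phi x)%:E = m%:E)%E).

Let C0 : 0 <= C.
Proof. by have := le_trans (h0 0) (hC 0); rewrite pmulr_lge0// cauchy_gt0. Qed.

Lemma measurable_half_conv_integrand (x : R) :
  measurable_fun setT (fun u : R => (h (x - u) * phi u)%:E).
Proof.
apply/measurable_EFinP/measurable_funM => //.
exact: measurableT_comp mh (measurable_reflect x).
Qed.

(** By [cauchy_half] the factor [h (x - u)] is at most [4 * C * k x] on the range, which leaves at
    most the total mass of [phi]. Being valid at every [x], the bound later gives the global
    envelope of [dconv f f]. *)
Lemma half_conv_le x : (half_conv h phi x <= (4 * C * m * k x)%:E)%E.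
Proof.
have -> : (4 * C * m * k x)%:E = ((4 * C * k x)%:E * m%:E)%E.
  by rewrite -EFinM; congr EFin; ring.
have Ck0 : 0 <= 4 * C * k x by rewrite !mulr_ge0 ?cauchy_ge0.
have mp : measurable_fun setT (EFin \o phi) by exact/measurable_EFinP.
rewrite -phi_int -ge0_integralZl//; last by move=> u _; rewrite lee_fin.
apply: (@le_trans _ _ (\int[lambda]_(u in `[0%R, (x / 2)%R])
    ((4 * C * k x)%:E * (phi u)%:E))%E).
  apply: ge0_le_integral => //.
  - by move=> u _; rewrite lee_fin mulr_ge0.
  - exact: measurable_funTS (measurable_half_conv_integrand x).
  - by apply: measurable_funTS; apply: emeasurable_funM.
  - move=> u /=; rewrite in_itv/= => ux; rewrite -EFinM lee_fin ler_wpM2r//.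
    apply: (le_trans (hC _)); rewrite [4 * C]mulrC -mulrA ler_wpM2l//.
    exact: cauchy_half.
apply: ge0_subset_integral => //.
- by apply: emeasurable_funM.
- by move=> u _; rewrite -EFinM lee_fin mulr_ge0.
Qed.

Lemma half_conv_fin x : half_conv h phi x \is a fin_num.
Proof.
rewrite ge0_fin_numE; first exact: le_lt_trans (half_conv_le x) (ltry _).
by apply: integral_ge0 => u _; rewrite lee_fin mulr_ge0.
Qed.

(** Dominated convergence: [h (x - u) * phi u / k x] tends to [a * phi u] for fixed [u] and stays
    below [4 * C * phi u] on the range. The limit is tested along arbitrary sequences, and the
    moving range is absorbed into the integrand as a restriction. *)
Lemma half_conv_cvg (a : R) : h x / k x @[x --> +oo] --> a ->
  fine (half_conv h phi x) / k x @[x --> +oo] --> a * m.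
Proof.
move=> ha; apply/cvg_pinftyP => xn xnoo.
have mp : measurable_fun setT (EFin \o phi) by exact/measurable_EFinP.
pose F n (u : R) := ((h (xn n - u) * phi u)%:E * ((k (xn n))^-1)%:E)%E.
have kV n : 0 <= (k (xn n))^-1 by rewrite invr_ge0 cauchy_ge0.
have F0 n u : (0 <= F n u)%E by rewrite /F -EFinM lee_fin !mulr_ge0.
have mF n : measurable_fun setT (F n).
  apply: emeasurable_funM => //; exact: measurable_half_conv_integrand.
have iphi b : lambda.-integrable setT (fun u => (b * phi u)%:E).
  apply/integrableP; split; first exact/measurable_EFinP/measurable_funM.
  under eq_integral do rewrite /= normrM (ger0_norm (phi0 _)) EFinM.
  rewrite ge0_integralZl//.
  - by rewrite phi_int -EFinM ltry.
  - by move=> u _; rewrite lee_fin.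
have FE n : ((fine (half_conv h phi (xn n)) / k (xn n))%:E =
    \int[lambda]_u (F n \_ `[0%R, (xn n / 2)%R]) u)%E.
  rewrite EFinM fineK ?half_conv_fin// muleC -ge0_integralZl//; last 3 first.
  - exact: measurable_funTS (measurable_half_conv_integrand _).
  - by move=> u _; rewrite lee_fin mulr_ge0.
  - by rewrite lee_fin.
  by rewrite -integral_mkcond; apply: eq_integral => u _; rewrite muleC.
have aphi : (\int[lambda]_u (a * phi u)%:E = (a * m)%:E)%E.
  under eq_integral do rewrite EFinM.
  rewrite integralZl//; first by rewrite phi_int.
  by have := iphi 1; under eq_fun do rewrite mul1r.
suff Foo : (\int[lambda]_u (F n \_ `[0%R, (xn n / 2)%R]) u @[n --> \oo] -->
    \int[lambda]_u (a * phi u)%:E)%E.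
  have : (fine (half_conv h phi (xn n)) / k (xn n))%:E @[n --> \oo] --> (a * m)%:E.
    by rewrite (funext FE) -aphi.
  exact: fine_cvg.
apply: (@dominated_cvg _ _ _ lambda setT _ _ _
  (fun u => (4 * C * phi u)%:E)) => //.
- move=> n; apply: (measurable_restrictT (F n) _).1 => //.
  exact: measurable_funTS (mF n).
- move=> u _.
  have [u0|u0] := ltP u 0.
    rewrite phiN// mulr0; apply: cvg_near_cst; apply: nearW => n.
    by rewrite patchE /F phiN// mulr0 mul0e; case: ifP.
  rewrite (_ : (a * phi u)%:E = (a * phi u * 1)%:E); last by rewrite mulr1.
  (* Passing through [k (x - u)] separates the limit of [h / k] from the shift invariance of [k];
     once [x] is at least [2 * u], the point [u] lies in the range. *)
  apply: (@cvg_trans _ ((h (xn n - u) / k (xn n - u) * phi u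
      * (k (xn n - u) / k (xn n)))%:E @[n --> \oo])).
    apply: near_eq_cvg; near=> n.
    rewrite patchE ifT; last first.
      rewrite inE/= in_itv/= u0/= ler_pdivlMr//; near: n.
      by move/cvgryPge : xnoo; exact.
    rewrite /F -EFinM; congr EFin; field.
    by rewrite !gt_eqF// cauchy_gt0.
  apply: cvg_EFin; first exact: nearW.
  apply: cvgM; last exact: (cvg_comp _ _ xnoo (@cauchy_shift R u)).
  apply: cvgM; last exact: cvg_cst.
  exact: (cvg_comp _ _ (cvg_comp _ _ xnoo (@cvg_shift_pinfty R u)) ha).
- move=> n u _; rewrite patchE; case: ifPn => [uD|_]; last first.
    by rewrite abse0 lee_fin !mulr_ge0.
  have ux : 0 <= u <= xn n / 2 by move: uD; rewrite inE/= in_itv.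
  rewrite gee0_abs// /F -EFinM lee_fin ler_pdivrMr ?cauchy_gt0//.
  rewrite mulrAC ler_wpM2r//.
  apply: (le_trans (hC _)); rewrite [4 * C]mulrC -mulrA ler_wpM2l//.
  exact: cauchy_half.
Unshelve. all: by end_near. Qed.

End half_convolution.

(** * Discarding an exceptional set with vanishing tail measure *)

Section tail_equivalence.
Variable R : realType.
Notation lambda := (@lebesgue_measure R).
Notation k := (@cauchy_weight R).
Variable B : set R.
Hypotheses (mB : measurable B) (Bfin : (lambda B < +oo)%E)
  (Btail : fine (lambda (B `&` `[x, +oo[)) @[x --> +oo] --> (0 : R)).

(* [h'] is [h] with the exceptional set [B] filled in; only [h'] is required to
   be asymptotic to [a * k]. *)
Definition cauchy_tail (a : R) (h : R -> R) : Prop :=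
  [/\ measurable_fun setT h, (forall x, 0 <= h x) &
   exists (C : R) (h' : R -> R), [/\ measurable_fun setT h',
     (forall x, h x <= h' x <= C * k x), (forall x, ~ B x -> h x = h' x) &
     h' x / k x @[x --> +oo] --> a]].

Lemma cauchy_tail_le (a : R) (h : R -> R) : cauchy_tail a h ->
  exists C, forall x, h x <= C * k x.
Proof.
move=> [_ _ [C [h' [_ hh' _ _]]]]; exists C => x.
by have /andP[/le_trans] := hh' x; exact.
Qed.

Lemma cauchy_tail_bound (a : R) (h : R -> R) : cauchy_tail a h ->
  exists M, forall x, h x <= M.
Proof.
move=> hh; have [_ h0 _] := hh; have [C hC] := cauchy_tail_le hh; exists C => x.
apply: (le_trans (hC x)); rewrite ler_piMr ?cauchy_le1//.
by have := le_trans (h0 x) (hC x); rewrite pmulr_lge0// cauchy_gt0.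
Qed.

(** The limit is known for the filled-in [h']. Passing back to [h] only affects those [u] with
    [x - u] in [B]; there [x - u] is at least [x / 2], and the integrand is at most
    [4 * C * M * k x], so the loss is [o(k x)]. *)
Lemma half_conv_cauchy_tail (a m : R) (h phi : R -> R) :
  cauchy_tail a h ->
  measurable_fun setT phi -> (forall x, 0 <= phi x) ->
  (forall x, x < 0 -> phi x = 0) -> (exists M, forall x, phi x <= M) ->
  (\int[lambda]_x (phi x)%:E = m%:E)%E ->
  fine (half_conv h phi x) / k x @[x --> +oo] --> a * m.
Proof.
move=> [mh h0 [C [h' [mh' hh' hB ha]]]] mphi phi0 phiN [M phiM] phi_int.
have h'0 x : 0 <= h' x by have /andP[+ _] := hh' x; exact: le_trans.
have h'C x : h' x <= C * k x by have /andP[] := hh' x.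
have hC x : h x <= C * k x by have /andP[/le_trans + ?] := hh' x; exact.
have C0 : 0 <= C.
  by have := le_trans (h0 0) (hC 0); rewrite pmulr_lge0// cauchy_gt0.
have M0 : 0 <= M by exact: le_trans (phi0 0) (phiM 0).
have cvg' := half_conv_cvg mh' h'0 h'C mphi phi0 phiN phi_int ha.
have fin' x := half_conv_fin mh' h'0 h'C mphi phi0 phi_int x.
have fin x := half_conv_fin mh h0 hC mphi phi0 phi_int x.
have mi x := measurable_half_conv_integrand mh mphi x.
have mi' x := measurable_half_conv_integrand mh' mphi x.
pose t x := fine (lambda (B `&` `[x / 2, +oo[)).
have tfin (x : R) : lambda (B `&` `[x, +oo[) \is a fin_num.
  rewrite ge0_fin_numE//; apply: le_lt_trans Bfin.
  by apply: le_measure; rewrite ?inE//; apply: measurableI.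
have t0 : 4 * C * M * t x @[x --> +oo] --> (0 : R).
  rewrite -[X in _ --> X](mulr0 (4 * C * M)); apply: cvgM; first exact: cvg_cst.
  apply: cvg_comp Btail; apply/cvgryPge => A; near=> x.
  rewrite ler_pdivlMr//; near: x; exact: nbhs_pinfty_ge (num_real _).
have half_le x : (half_conv h phi x <= half_conv h' phi x)%E.
  apply: ge0_le_integral => //.
  - by move=> u _; rewrite lee_fin mulr_ge0.
  - exact: measurable_funTS (mi x).
  - exact: measurable_funTS (mi' x).
  - by move=> u _; rewrite lee_fin ler_wpM2r//; have /andP[] := hh' (x - u).
have half_ge x : (half_conv h' phi x <=
    half_conv h phi x + (4 * C * M * k x * t x)%:E)%E.
  (* [D] is the reflected tail of [B]: it contains every [u] of the range where [h] and [h'] can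
     differ, and reflection gives it measure [t x]. *)
  pose D : set R := [set u | (B `&` `[x / 2, +oo[) (x - u)].
  have mD : measurable D.
    rewrite /D -[X in measurable X]setTI; apply: (measurable_reflect x) => //.
    exact: measurableI.
  have b0 : 0 <= 4 * C * M * k x by rewrite !mulr_ge0 ?cauchy_ge0.
  have mD' : measurable_fun setT (fun u : R => (4 * C * M * k x * \1_D u)%:E).
    by apply/measurable_EFinP/measurable_funM => //; exact: measurable_indic.
  apply: (@le_trans _ _ (\int[lambda]_(u in `[0%R, (x / 2)%R])
      ((h (x - u) * phi u)%:E + (4 * C * M * k x * \1_D u)%:E))%E).
    apply: ge0_le_integral => //.
    - by move=> u _; rewrite lee_fin mulr_ge0.
    - exact: measurable_funTS (mi' x).
    - by apply: measurable_funTS; apply: emeasurable_funD; [exact: mi|exact: mD'].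
    - move=> u /=; rewrite in_itv/= => ux; rewrite -EFinD lee_fin.
      have [Bxu|Bxu] := pselect (B (x - u)); last first.
        by rewrite (hB _ Bxu) lerDl mulr_ge0// indicE.
      rewrite indicE mem_set ?mulr1; last first.
        by split => //=; rewrite in_itv/= andbT; lra.
      apply: ler_wpDl; first exact: mulr_ge0.
      rewrite mulrAC; apply: ler_pM => //.
      apply: (le_trans (h'C _)); rewrite [4 * C]mulrC -mulrA ler_wpM2l//.
      exact: cauchy_half.
  rewrite ge0_integralD//; last 4 first.
  - by move=> u _; rewrite lee_fin mulr_ge0.
  - exact: measurable_funTS (mi x).
  - by move=> u _; rewrite lee_fin mulr_ge0// indicE.
  - exact: measurable_funTS mD'.
  rewrite leeD2l//; under eq_integral do rewrite EFinM.
  rewrite ge0_integralZl//; last first.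
    exact/measurable_EFinP/measurable_indic.
  rewrite integral_indic// [leRHS]EFinM; apply: lee_wpmul2l.
    by rewrite lee_fin.
  rewrite /t fineK//.
  rewrite -(@lebesgue_measure_reflect _ x); last exact: measurableI.
  by apply: le_measure; rewrite ?inE//; apply: measurableI.
apply: (@squeeze_cvgr _ _ _ _
    (fun x => fine (half_conv h' phi x) / k x - 4 * C * M * t x)
    (fun x => fine (half_conv h' phi x) / k x)) => //; last first.
  by rewrite -[X in _ --> X]subr0; exact: cvgB.
apply: nearW => x; have kx := @cauchy_gt0 R x; apply/andP; split.
  rewrite lerBlDr ler_pdivrMr// mulrDl divfK ?gt_eqF//.
  have := half_ge x; rewrite -[X in (_ <= X + _)%E]fineK//.
  rewrite -[X in (X <= _)%E]fineK//.
  by rewrite -EFinD lee_fin -!mulrA [t x * _]mulrC.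
apply: ler_wpM2r; first by rewrite invr_ge0 ltW.
exact: (fine_le (fin x) (fin' x) (half_le x)).
Unshelve. all: by end_near. Qed.

(* The reflection u -> x - u exchanges the two halves of the convolution. *)
Lemma dconv_self (h : R -> R) (x : R) : measurable_fun setT h ->
  (forall x, 0 <= h x) -> (forall x, x < 0 -> h x = 0) ->
  dconv h h x = (2%:E * half_conv h h x)%E.
Proof.
move=> mh h0 hN; have mF := measurable_half_conv_integrand mh mh x.
pose F (u : R) := (h (x - u) * h u)%:E.
have F0 u : (0 <= F u)%E by rewrite lee_fin mulr_ge0.
(* Since [h] vanishes on the negative axis, the lower half-line contributes only through
   [[0, x / 2]]. *)
have half : (\int[lambda]_(u in `]-oo, (x / 2)%R]) F u = half_conv h h x)%E.
  rewrite /half_conv integral_mkcond [RHS]integral_mkcond; apply: eq_integral => u _.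
  rewrite !patchE; have [u0|u0] := ltP u 0.
    by rewrite /F (hN u u0) mulr0 !if_same.
  by congr (if _ then _ else _); apply/idP/idP; rewrite !inE/= !in_itv/= u0.
rewrite /dconv -/(F _) -(setvU `]-oo, (x / 2)%R]) setCitvl.
rewrite ge0_integral_setU//=; last 3 first.
- exact: measurable_funTS mF.
- by move=> u _; exact: F0.
- by apply/disj_setPS => u [] /=; rewrite !in_itv/=; lra.
rewrite half (@ge0_integral_reflect _ x `]x / 2, +oo[%classic F)//; last first.
  exact: measurable_funTS mF.
have -> : [set u | `]x / 2, +oo[%classic (x - u)] = `]-oo, x / 2[%classic.
  by apply/seteqP; split => u /=; rewrite !in_itv/=; lra.
have -> : (\int[lambda]_(u in `]-oo, (x / 2)%R[) F (x - u)%R = half_conv h h x)%E.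
  rewrite -half; under eq_integral do rewrite /F subKr mulrC.
  rewrite integral_itv_bndo_bndc//; exact: measurable_funTS mF.
by rewrite EFinD ge0_muleDl// mul1e.
Qed.

End tail_equivalence.

(** * Asymptotic equivalence and long tails by comparison with the weight *)

Section asymptotics.
Variable R : realType.
Notation k := (@cauchy_weight R).

Lemma cvg_div_shift (f : R -> R) (l a : R) :
  f x / k x @[x --> +oo] --> l -> f (x + a) / k x @[x --> +oo] --> l.
Proof.
move=> fl; rewrite -[l]mulr1.
have -> : (fun x => f (x + a) / k x) =
    (fun x => f (x - - a) / k (x - - a) * (k (x - - a) / k x)).
  apply/funext => x; rewrite opprK; field.
  by rewrite !gt_eqF// cauchy_gt0.
apply: cvgM; last exact: cauchy_shift.
exact: (cvg_comp _ _ (@cvg_shift_pinfty R (- a)) fl).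
Qed.

(** A positive limit relative to [k] forces eventual positivity, and two functions with the same
    limit have ratio tending to 1. All the equivalences below are obtained this way. *)
Lemma asympt_cauchy (F G : R -> \bar R) (l : R) : 0 < l ->
  (forall x, F x \is a fin_num) -> (forall x, G x \is a fin_num) ->
  fine (F x) / k x @[x --> +oo] --> l ->
  fine (G x) / k x @[x --> +oo] --> l -> asympt F G.
Proof.
move=> l0 finF finG Fl Gl.
have pos (H : R -> \bar R) : (forall x, H x \is a fin_num) ->
    fine (H x) / k x @[x --> +oo] --> l -> \forall x \near +oo, (0 < H x < +oo)%E.
  move=> finH /cvgr_gt /(_ _ l0); apply: filterS => x.
  rewrite pmulr_lgt0 1?invr_gt0 ?cauchy_gt0// => Hx.
  by rewrite -(fineK (finH x)) lte_fin Hx ltry.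
split; first by near=> x; split; near: x; exact: pos.
rewrite -(divff (lt0r_neq0 l0)).
have -> : (fun x => fine (F x) / fine (G x)) =
    (fun x => (fine (F x) / k x) / (fine (G x) / k x)).
  apply/funext => x; have kx := lt0r_neq0 (cauchy_gt0 x).
  by rewrite (invfM (fine (G x))) (invrK (k x)) mulrACA (mulVf kx) mulr1.
apply: cvgM => //; apply: cvgV => //; exact: lt0r_neq0.
Unshelve. all: by end_near. Qed.

Lemma classL_cauchy (g : R -> R) (l : R) : 0 < l ->
  measurable_fun setT g -> (forall x, 0 <= g x) ->
  g x / k x @[x --> +oo] --> l -> classL g.
Proof.
move=> l0 mg g0 gl.
have gl' a : asymptR (fun x => g (x + a)) g.
  by apply: (asympt_cauchy l0) => //; exact: cvg_div_shift.
split => //; split => //; split => //.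
(* Eventual positivity is part of the equivalence for the shift [0]. *)
by have [+ _] := gl' 0; apply: filterS => x [_ /andP[]]; rewrite lte_fin.
Qed.

End asymptotics.

(** * Masses of intervals of fixed length *)

Section local_mass.
Variable R : realType.
Notation lambda := (@lebesgue_measure R).
Notation k := (@cauchy_weight R).
Variable B : set R.
Hypotheses (mB : measurable B) (Bfin : (lambda B < +oo)%E)
  (Btail : fine (lambda (B `&` `[x, +oo[)) @[x --> +oo] --> (0 : R)).

Lemma Ioc_itv (a b : R) : Ioc a b = `]a, b]%classic.
Proof. by apply/seteqP; split => x /=; rewrite /Ioc/= in_itv. Qed.

Lemma measurable_Ioc (a b : R) : measurable (Ioc a b).
Proof. by rewrite Ioc_itv. Qed.

(** Substituting [y = x + c - u] turns the mass of [Ioc x (x + c)] into the half convolution, at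
    [x + c], of [h] with the indicator of [[0, c[], whose integral is [c]. *)
Lemma local_mass_cvg (a c : R) (h : R -> R) : 0 < c -> cauchy_tail B a h ->
  fine (\int[lambda]_(y in Ioc x (x + c)) (h y)%:E)%E / k x
    @[x --> +oo] --> a * c.
Proof.
move=> c0 hh; have [mh h0 _] := hh.
pose phi : R -> R := \1_(`[0, c[%classic : set R).
have phi_int : (\int[lambda]_x (phi x)%:E = c%:E)%E.
  rewrite integral_indic// setIT/= lebesgue_measure_itv/= lte_fin c0.
  by rewrite oppr0 adde0.
have cvg_half : fine (half_conv h phi x) / k x @[x --> +oo] --> a * c.
  apply: (half_conv_cauchy_tail mB Bfin Btail hh) => //.
  - exact: measurable_indic.
  - move=> x x0; rewrite /phi indicE memNset//= in_itv/= => /andP[]; lra.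
  - by exists 1 => x; rewrite /phi indicE; case: (_ \in _); rewrite ?ler01.
have := @cvg_div_shift _ (fine \o half_conv h phi) _ c cvg_half.
apply: cvg_trans; apply: near_eq_cvg; near=> x.
(* This puts [[0, c[] inside the range [[0, (x + c) / 2]]. *)
have cx : c <= x by near: x; exact: nbhs_pinfty_ge (num_real _).
congr (fine _ / _); rewrite /half_conv.
rewrite (@ge0_integral_reflect _ (x + c) (Ioc x (x + c)))//; last 3 first.
- exact: measurable_Ioc.
- by apply/measurable_EFinP; exact: measurable_funTS.
- by move=> y _; rewrite lee_fin.
rewrite integral_mkcond [RHS]integral_mkcond; apply: eq_integral => u _.
rewrite !patchE /phi indicE.
have -> : (u \in [set u | Ioc x (x + c) (x + c - u)]) = (u \in `[0, c[%classic).
  by apply/idP/idP; rewrite !inE /Ioc/= in_itv/=; lra.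
have [uc|uc] := boolP (u \in `[0, c[%classic); last by rewrite mulr0 if_same.
rewrite mulr1 ifT//; move: uc; rewrite !inE/= !in_itv/=; lra.
Unshelve. all: by end_near. Qed.

End local_mass.

(** * Self-convolution and the local and density subexponential classes *)

Section subexponential.
Variable R : realType.
Notation lambda := (@lebesgue_measure R).
Notation k := (@cauchy_weight R).
Variable B : set R.
Hypotheses (mB : measurable B) (Bfin : (lambda B < +oo)%E)
  (Btail : fine (lambda (B `&` `[x, +oo[)) @[x --> +oo] --> (0 : R)).

Section self_convolution.
Variables (f : R -> R) (a : R).
Hypotheses (df : density f) (fN : forall x, x < 0 -> f x = 0)
  (ta : cauchy_tail B a f).

Let mf : measurable_fun setT f. Proof. by have [] := df. Qed.
Let f0 x : 0 <= f x. Proof. by have [_ []] := df. Qed.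
Let f_int : (\int[lambda]_x (f x)%:E = 1%:E)%E. Proof. by have [_ []] := df. Qed.

Lemma dconv_fin x : dconv f f x \is a fin_num.
Proof.
rewrite dconv_self// fin_numM//.
have [C fC] := cauchy_tail_le ta; exact: (half_conv_fin mf f0 fC mf f0 f_int).
Qed.

Lemma dconv_cvg : fine (dconv f f x) / k x @[x --> +oo] --> 2 * a.
Proof.
have [C fC] := cauchy_tail_le ta.
have fin x := half_conv_fin mf f0 fC mf f0 f_int x.
under eq_fun do rewrite dconv_self// fineM// ?fin//= -mulrA.
apply: cvgM; first exact: cvg_cst.
rewrite -[a]mulr1; apply: (half_conv_cauchy_tail mB Bfin Btail ta) => //.
exact: cauchy_tail_bound ta.
Qed.

Let g (x : R) := fine (dconv f f x).

Lemma mconv_law_fine (A : set R) : measurable A ->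
  mconv (law df) (law df) A = (\int[lambda]_(x in A) (fine (dconv f f x))%:E)%E.
Proof.
move=> mA; rewrite mconv_law//; apply: eq_integral => x _.
by rewrite fineK// dconv_fin.
Qed.

Lemma density_dconv : density g.
Proof.
have mg : measurable_fun setT g.
  by apply: measurableT_comp (measurable_dconv mf f0 mf f0).
split => //; split.
  by move=> x; apply: fine_ge0; apply: integral_ge0 => u _; rewrite lee_fin mulr_ge0.
rewrite -mconv_law_fine// /mconv.
(* The total mass is read off from the convolution of the measures: every translate of the line has
   mass 1. *)
transitivity (\int[law df]_x cst 1%E x)%E.
  by apply: eq_integral => x _; exact: (@probability_setT _ _ _ (law df)).
by rewrite integral_cst// mul1e; exact: (@probability_setT _ _ _ (law df)).
Qed.

Lemma dconv_neg x : x < 0 -> g x = 0.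
Proof.
move=> x0; rewrite /g dconv_self// /half_conv set_itv_ge ?integral_set0 ?mule0//.
by rewrite bnd_simp -ltNge; lra.
Qed.

(** The convolution has a genuine limit relative to [k], so it serves as its own filled-in
    function. *)
Lemma cauchy_tail_dconv : cauchy_tail B (2 * a) g.
Proof.
have [mg [g0 _]] := density_dconv; split => //.
have [C fC] := cauchy_tail_le ta.
(* The factor 2 counts the two halves; [4 * C * 1] is the constant of [half_conv_le] for total mass
   1. *)
exists (2 * (4 * C * 1)), g; split => //; last exact: dconv_cvg.
move=> x; rewrite lexx/= /g dconv_self// fineM//; last first.
  exact: (half_conv_fin mf f0 fC mf f0 f_int).
rewrite -mulrA ler_wpM2l// -lee_fin fineK; last first.
  exact: (half_conv_fin mf f0 fC mf f0 f_int).
exact: (half_conv_le mf f0 fC mf f0 f_int).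
Qed.

End self_convolution.

Variables (f : R -> R) (a : R).
Hypotheses (a0 : 0 < a) (df : density f) (fN : forall x, x < 0 -> f x = 0)
  (ta : cauchy_tail B a f).

(** Second round: the results on self-convolution apply to [g] with [2 * a] in place of [a], so both
    [dconv g g] and [2 * g] have limit [2 * (2 * a)] relative to [k]. *)
Lemma Sd_dconv : Sd (fun x => fine (dconv f f x)).
Proof.
set g := fun x => _.
have dg : density g := density_dconv df fN ta.
have tg : cauchy_tail B (2 * a) g := cauchy_tail_dconv df fN ta.
have gN : forall x, x < 0 -> g x = 0 := dconv_neg df fN.
have [mg [g0 _]] := dg; have cg := dconv_cvg df fN ta.
have a20 : 0 < 2 * a by rewrite mulr_gt0.
split; first by split => //; exact: classL_cauchy cg.
apply: (@asympt_cauchy _ _ _ (2 * (2 * a))) => //.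
- by rewrite mulr_gt0.
- exact: dconv_fin dg gN tg.
- exact: dconv_cvg dg gN tg.
- under eq_fun do rewrite /= -mulrA; apply: cvgM => //; exact: cvg_cst.
Qed.

Lemma Sac_mconv_law : Sac (mconv (law df) (law df)).
Proof.
exists (fun x => fine (dconv f f x)); split; first exact: Sd_dconv.
move=> A mA; exact: (mconv_law_fine df fN ta mA).
Qed.

(** [local_mass_cvg] is used twice: for [f], with limit [a * c], and for the density [dconv f f] of
    the convolution square, with limit [2 * a * c]. *)
Lemma Sloc_law : Sloc (law df).
Proof.
move=> c c0.
have cvgF : fine (law df (Ioc x (x + c))) / k x @[x --> +oo] --> a * c.
  exact: (local_mass_cvg mB Bfin Btail c0 ta).
have tg := cauchy_tail_dconv df fN ta.
have fin2 x : mconv (law df) (law df) (Ioc x (x + c)) =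
    (\int[lambda]_(y in Ioc x (x + c)) (fine (dconv f f y))%:E)%E.
  exact: (mconv_law_fine df fN ta (measurable_Ioc _ _)).
have fin1 x : law df (Ioc x (x + c)) \is a fin_num.
  by apply: fin_num_measure; exact: measurable_Ioc.
split.
  apply: (@classL_cauchy _ _ (a * c)) => //.
  - by rewrite mulr_gt0.
  (* Measurability in [x]: the mass of [Ioc x (x + c)] is an increment of the distribution function,
     which is monotone. *)
  - pose F x := fine (law df `]-oo, x]%classic).
    have FF : {homo F : x y / x <= y}.
      move=> x y xy; apply: fine_le; rewrite ?fin_num_measure//.
      by apply: le_measure; rewrite ?inE//; apply: subset_itvl; rewrite bnd_simp.
    have mF : measurable_fun setT F by exact: nondecreasing_measurable.
    rewrite (_ : (fun x => _) = (fun x => F (x + c) - F x)).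
      apply: measurable_funB => //; apply: (measurableT_comp mF).
      exact: measurable_funD.
    apply/funext => x; apply/eqP; rewrite eq_sym subr_eq; apply/eqP.
    rewrite /F -fineD ?fin_num_measure//; last exact: measurable_Ioc.
    rewrite -measureU//; last 2 first.
    + exact: measurable_Ioc.
    + by apply/seteqP; split => // y [] /=; rewrite /Ioc/= in_itv/=; lra.
    congr (fine (law df _)).
    apply/seteqP; split => y /=; rewrite /Ioc/= !in_itv/=; [|case];
      have := c0; lra.
  - by move=> x; exact/fine_ge0.
apply: (@asympt_cauchy _ _ _ (2 * (a * c))).
- by rewrite !mulr_gt0.
- move=> x; rewrite fin2 -(lawE (density_dconv df fN ta)).
  by apply: fin_num_measure; exact: measurable_Ioc.
- by move=> x; rewrite fin_numM.
- under eq_fun do rewrite fin2.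
  by rewrite mulrA; exact: (local_mass_cvg mB Bfin Btail c0 tg).
- under eq_fun do rewrite fineM// -mulrA.
  by apply: cvgM => //; exact: cvg_cst.
Qed.

End subexponential.

(** * The density with holes and the failure of uniformity *)

Section holes.
Variable R : realType.
Notation lambda := (@lebesgue_measure R).
Notation k := (@cauchy_weight R).

(** The lengths sum to 1, and each is an admissible [c] in [(0, 1]]. The holes are half-open like
    the intervals in [unif_local_asympt], so each one is exactly such an interval. *)
Definition hole (n : nat) : set R := Ioc n%:R (n%:R + 1 / 2 ^+ n.+1).

Definition holes : set R := \bigcup_n hole n.

Lemma measurable_holes : measurable holes.
Proof. by apply: bigcup_measurable => n _; exact: measurable_Ioc. Qed.

Lemma holes_fin : (lambda holes < +oo)%E.
Proof.
apply: (@le_lt_trans _ _ (\sum_(0 <= n <oo) lambda (hole n))%E).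
  apply: measure_sigma_subadditive => //.
  - by move=> n; exact: measurable_Ioc.
  - exact: measurable_holes.
apply: (@le_lt_trans _ _ (1%:E)); last exact: ltry.
apply: le_trans (@epsilon_trick0 R 1 xpredT _); last by [].
apply: lee_nneseries => // n _.
rewrite /hole Ioc_itv lebesgue_measure_itv/= lte_fin ltrDl divr_gt0 ?exprn_gt0//.
by rewrite -EFinD addrAC subrr add0r natrX.
Qed.

(** Continuity from above along integer thresholds, the tails having empty intersection and finite
    measure; monotonicity in the threshold extends the limit to real [x]. *)
Lemma holes_tail :
  fine (lambda (holes `&` `[x, +oo[)) @[x --> +oo] --> (0 : R).
Proof.
have mF (x : R) : measurable (holes `&` `[x, +oo[%classic).
  by apply: measurableI => //; exact: measurable_holes.
have finF (x : R) : lambda (holes `&` `[x, +oo[) \is a fin_num.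
  rewrite ge0_fin_numE//; apply: le_lt_trans holes_fin.
  by apply: le_measure; rewrite ?inE//; [exact: mF|exact: measurable_holes].
pose F (n : nat) := holes `&` `[n%:R, +oo[%classic.
have capF : \bigcap_n F n = set0.
  apply/seteqP; split => // x h.
  have [_] := h (Num.truncn `|x|).+1 I; rewrite /= in_itv/= andbT.
  by rewrite leNgt (le_lt_trans (ler_norm x))// truncnS_gt.
have h : fine (lambda (F n)) @[n --> \oo] --> (0 : R).
  suff : (lambda \o F) n @[n --> \oo] --> lambda (\bigcap_n F n).
    by rewrite capF measure0; exact: fine_cvg.
  apply: (@nonincreasing_cvg_mu _ (measurableTypeR R) R lambda F).
  - by rewrite -ge0_fin_numE//; exact: finF.
  - by move=> n; exact: mF.
  - by rewrite capF; exact: measurable0.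
  - move=> m n mn; apply/subsetPset => x [Bx] /=.
    rewrite in_itv/= andbT => nx; split=> //=; rewrite in_itv/= andbT.
    by apply: le_trans nx; rewrite ler_nat.
apply/cvgrPdist_lt => /= e e0.
move/cvgrPdist_lt : h => /(_ e e0)[N _ /(_ N (leqnn N))] /= h.
near=> x; apply: le_lt_trans h; rewrite !sub0r !normrN.
rewrite !ger0_norm ?fine_ge0//; apply: (fine_le (finF _) (finF _)).
apply: le_measure; rewrite ?inE; [exact: mF|exact: mF|].
apply: setIS => y /=; rewrite !in_itv/= !andbT; apply: le_trans.
near: x; exact: nbhs_pinfty_ge (num_real _).
Unshelve. all: by end_near. Qed.

Let G : set R := `[0, +oo[%classic `\` holes.

Let mG : measurable G.
Proof. by apply: measurableD => //; exact: measurable_holes. Qed.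

Let Z : R := fine (\int[lambda]_(x in G) (k x)%:E)%E.

Let mk : measurable_fun setT (EFin \o k).
Proof. apply/measurable_EFinP; exact: measurable_cauchy. Qed.

Let Z_fin : (\int[lambda]_(x in G) (k x)%:E = Z%:E)%E.
Proof.
rewrite /Z fineK// ge0_fin_numE; last first.
  by apply: integral_ge0 => x _; rewrite lee_fin cauchy_ge0.
apply: le_lt_trans (integral_cauchy_fin R); apply: ge0_subset_integral => //.
- exact: measurable_funTS mk.
- by move=> x _; rewrite lee_fin cauchy_ge0.
- exact: subDsetl.
Qed.

(** The interval []1/2, 1]] meets no hole: hole 0 ends at 1/2 and the others start at 1 or later.
    There [k] is at least 1/2, so [Z] is at least 1/4. *)
Let Z_gt0 : 0 < Z.
Proof.
have IG : `]1 / 2, 1]%classic `<=` G.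
  move=> x /=; rewrite in_itv/= => /andP[x12 x1]; split.
    by rewrite /= in_itv/=; lra.
  move=> [[|n] _]; rewrite /hole/Ioc/= => /andP[nx xn]; first by lra.
  by have : (1 : R) <= n.+1%:R by [rewrite ler1n]; lra.
rewrite -lte_fin -Z_fin; apply: (@lt_le_trans _ _ (4^-1)%:E).
  by rewrite lte_fin.
apply: (@le_trans _ _ (\int[lambda]_(x in `](1 / 2)%R, 1%R]) (2^-1)%:E)%E).
  rewrite integral_cst//= lebesgue_measure_itv/= lte_fin ifT; last lra.
  by rewrite -EFinD -EFinM lee_fin; lra.
apply: (@le_trans _ _ (\int[lambda]_(x in `](1 / 2)%R, 1%R]) (k x)%:E)%E).
  apply: ge0_le_integral => //.
  - exact: measurable_funTS mk.
  - move=> x /=; rewrite in_itv/= lee_fin => /andP[x12 x1].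
    rewrite lef_pV2 ?posrE//; first nra.
    by rewrite ltr_wpDr// sqr_ge0.
apply: ge0_subset_integral => //.
- exact: measurable_funTS mk.
- by move=> x _; rewrite lee_fin cauchy_ge0.
Qed.

Definition pitted : R -> R := (fun x => Z^-1 * k x) \_ G.

Lemma pitted_ge0 x : 0 <= pitted x.
Proof.
rewrite /pitted patchE; case: ifP => // _.
by rewrite mulr_ge0 ?cauchy_ge0// invr_ge0 ltW.
Qed.

Let mZk : measurable_fun setT (fun x => Z^-1 * k x).
Proof. by apply: measurable_funM => //; exact: measurable_cauchy. Qed.

Lemma measurable_pitted : measurable_fun setT pitted.
Proof.
by apply: (measurable_restrictT _ _).1 => //; exact: measurable_funTS mZk.
Qed.

Lemma density_pitted : density pitted.
Proof.
split; first exact: measurable_pitted.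
split; first exact: pitted_ge0.
transitivity (\int[lambda]_(x in G) ((Z^-1)%:E * (k x)%:E))%E.
  rewrite [RHS]integral_mkcond; apply: eq_integral => x _.
  by rewrite /pitted !patchE; case: ifP.
rewrite ge0_integralZl//.
- by rewrite Z_fin -EFinM mulVf// gt_eqF.
- exact: measurable_funTS mk.
- by move=> x _; rewrite lee_fin cauchy_ge0.
- by rewrite lee_fin invr_ge0 ltW.
Qed.

Lemma pitted_holes x : holes x -> pitted x = 0.
Proof. by move=> Bx; rewrite /pitted patchE ifN// notin_setE => -[]. Qed.

Lemma pitted_neg x : x < 0 -> pitted x = 0.
Proof.
move=> x0; rewrite /pitted patchE ifN// notin_setE => -[/=].
by rewrite in_itv/= andbT leNgt x0.
Qed.

Lemma cauchy_tail_pitted : exists2 a, 0 < a & cauchy_tail holes a pitted.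
Proof.
exists Z^-1; first by rewrite invr_gt0.
have Zk0 x : 0 <= Z^-1 * k x by rewrite mulr_ge0 ?cauchy_ge0// invr_ge0 ltW.
split; [exact: measurable_pitted|exact: pitted_ge0|].
(* Only the holes are filled back in: the negative axis lies outside [holes], so the filled-in
   function must vanish there as [pitted] does. *)
exists Z^-1, ((fun x => Z^-1 * k x) \_ `[0, +oo[%classic); split.
- by apply: (measurable_restrictT _ _).1 => //; exact: measurable_funTS mZk.
- move=> x; rewrite /pitted !patchE; case: ifPn => [/set_mem[x0 _]|_].
    by rewrite mem_set// lexx.
  by case: ifP; rewrite ?lexx ?Zk0.
- move=> x Bx; rewrite /pitted !patchE; congr (if _ then _ else _).
  by apply/idP/idP; rewrite !inE /G/=; [case|].
- apply: cvg_near_cst; near=> x; rewrite patchE ifT.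
    by rewrite mulfK// gt_eqF// cauchy_gt0.
  rewrite inE/= in_itv/= andbT; near: x; exact: nbhs_pinfty_ge (num_real _).
Unshelve. all: by end_near. Qed.

(** Whatever [p] is, taking for [x] the right end of a hole and for [c] its length makes the mass
    zero, so the deviation is exactly 1; this contradicts uniformity with tolerance 1. *)
Lemma not_USloc_pitted (df : density pitted) : ~ USloc (law df).
Proof.
move=> [_ [p [_ /(_ 1 ltr01)]]] [M [_ unif]].
(* A hole lying wholly beyond the threshold [M]; [e] is its length. *)
pose n := (Num.truncn `|M|).+1; pose e : R := 1 / 2 ^+ n.+1.
have Mn : M < n%:R by rewrite (le_lt_trans (ler_norm M))// truncnS_gt.
have e0 : 0 < e by rewrite divr_gt0// exprn_gt0.
have e1 : e <= 1.
  by rewrite ler_pdivrMr ?exprn_gt0// mul1r exprn_ege1// ler1n.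
have := unif (n%:R + e); rewrite (lt_le_trans Mn) ?lerDl ?ltW// => /(_ isT e).
rewrite e0 e1 addrK => /(_ isT).
rewrite lawE (eq_integral (cst 0%E)); last first.
  by move=> x /set_mem xn; rewrite pitted_holes//; exists n.
by rewrite integral0 mulr0 mul0r sub0r normrN normr1 ltxx.
Qed.

End holes.

Theorem theorem1p1 (R : realType) :
  exists mu : probability R R,
    mu [set x : R | x < 0] = 0%E /\
    Sloc mu /\ ~ USloc mu /\ Sac (mconv mu mu).
Proof.
have df := density_pitted R.
have [a a0 ta] := cauchy_tail_pitted R.
have mB := @measurable_holes R; have finB := holes_fin R.
have tailB := @holes_tail R; have fN := @pitted_neg R.
exists (law df); split; [|split; [|split]].
- rewrite lawE (eq_integral (cst 0%E)) ?integral0// => x /set_mem x0.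
  by rewrite pitted_neg.
- exact: (Sloc_law mB finB tailB a0 df fN ta).
- exact: not_USloc_pitted.
- exact: (Sac_mconv_law mB finB tailB a0 df fN ta).
Qed.
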